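(* For every integer $n\ge 1$, the number of labeled $n$-element semiorders of length at most one is equal to the number of ordered partitions of $[n]=\{1,\dots,n\}$.
   Context: A semiorder is a finite poset with no induced subposet isomorphic to $\mathbf{2}+\mathbf{2}$ (disjoint union of two 2-element chains with no other comparabilities) or $\mathbf{3}+\mathbf{1}$ (disjoint union of a 3-element chain and a single incomparable element). Its length is the length of a longest chain (a chain with $\ell+1$ elements has length $\ell$). A labeled $n$-element semiorder is a semiorder on the set $\{1,\dots,n\}$ (equivalently, labelings of $n$-element semiorders by $1,\dots,n$ are counted up to label-preserving isomorphism). An ordered partition of a set is a partition of the set into pairwise disjoint nonempty subsets, together with a linear ordering of these subsets. *)

(* Defs.v *)
From mathcomp Require Import all_boot.

Set Implicit Arguments.
Unset Strict Implicit.
Unset Printing Implicit Defensive.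

(* Finite orders are encoded by their graph: (x, y) \in R means x <= y in the
   (reflexive) order R, so that orders on a finite type can be counted. *)

Definition rel_of (T : finType) (R : {set T * T}) : rel T :=
  fun x y => (x, y) \in R.

Definition partial_order_on (T : finType) (A : {set T}) (R : {set T * T}) :
    bool :=
  [&& R \subset setX A A,
      [forall x in A, rel_of R x x],
      [forall x, forall y, rel_of R x y && rel_of R y x ==> (x == y)] &
      [forall x, forall y, forall z,
         rel_of R x y && rel_of R y z ==> rel_of R x z]].

Definition chain (T : finType) (R : {set T * T}) (C : {set T}) : bool :=
  [forall x in C, forall y in C, rel_of R x y || rel_of R y x].

Definition linear_order_on (T : finType) (A : {set T}) (R : {set T * T}) :
    bool :=
  partial_order_on A R && chain R A.

Definition chain_le (m : nat) : rel 'I_m := fun i j => i <= j.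

(* The order of the disjoint union of an a-element and a b-element chain. *)
Definition two_chains_le (a b : nat) : rel ('I_a + 'I_b) :=
  fun u v =>
    match u, v with
    | inl i, inl j => chain_le i j
    | inr i, inr j => chain_le i j
    | _, _ => false
    end.

Definition has_induced (S T : finType) (leS : rel S) (leT : rel T) : bool :=
  [exists f : {ffun S -> T},
     injectiveb f && [forall i, forall j, leT (f i) (f j) == leS i j]].

Definition semiorder (T : finType) (R : {set T * T}) : bool :=
  [&& partial_order_on [set: T] R,
      ~~ has_induced (@two_chains_le 2 2) (rel_of R) &
      ~~ has_induced (@two_chains_le 3 1) (rel_of R)].

Definition order_length (T : finType) (R : {set T * T}) : nat :=
  \max_(C : {set T} | chain R C) #|C|.-1.

(* Labels 1, ..., n are represented by 'I_n = {0, ..., n-1}. *)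
Definition semiorders_length_le1 (n : nat) : {set {set 'I_n * 'I_n}} :=
  [set R | semiorder R && (order_length R <= 1)].

(* A pair (P, L): a partition P (the library notion, whose blocks are nonempty)
   and a linear order L on its set of blocks. *)
Definition ordered_partitions (n : nat) :
    {set {set {set 'I_n}} * {set {set 'I_n} * {set 'I_n}}} :=
  [set PL | partition PL.1 [set: 'I_n] && linear_order_on PL.1 PL.2].

(* Main.v *)
(** Both families are in bijection with the ranks [f : T -> nat] whose image is
    an initial segment of [nat].  Such an [f] is an ordered partition, read as
    "[x] lies in block number [f x]".  It also gives the semiorder in which
    [x < y] iff [f x] is even, [f y] is odd and [f x < f y]; the isolated points
    form the last block when the number of blocks is odd.  Conversely, in a
    poset of length at most one without induced 2+2 the strict up-sets are
    nested, so the minimal elements can be ranked by decreasing up-set, with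
    each other element [y] placed right after the last minimal element
    below [y]. *)
Require Import Defs.
From mathcomp Require Import all_boot.
From mathcomp Require Import zify.

Set Implicit Arguments.
Unset Strict Implicit.
Unset Printing Implicit Defensive.

(** * Functions onto an initial segment of [nat] *)

Definition gap_free (T : finType) (f : T -> nat) : bool :=
  [forall x, forall j : 'I_(f x), [exists y, f y == j]].

Lemma gap_freeP (T : finType) (f : T -> nat) :
  reflect (forall x j, j < f x -> exists y, f y = j) (gap_free f).
Proof.
apply: (iffP forallP) => [H x j jx | H x].
  by have /forallP/(_ (Ordinal jx))/existsP[y /eqP] := H x; exists y.
apply/forallP => j; have [y yj] := H x j (ltn_ord j).
by apply/existsP; exists y; apply/eqP.
Qed.

(** All of [0, ..., f x] are values of [f], which takes at most [#|T|] values. The bound lets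
    gap-free functions be counted as finite functions into ['I_#|T|]. *)
Lemma gap_free_lt_card (T : finType) (f : T -> nat) :
  gap_free f -> forall x, f x < #|T|.
Proof.
move=> /gap_freeP gf x.
rewrite cardE -(size_map f) -(size_iota 0 (f x).+1).
apply: uniq_leq_size; first exact: iota_uniq.
move=> j; rewrite mem_iota add0n /= ltnS leq_eqVlt => /orP[/eqP->|/gf[y <-]];
  by rewrite map_f ?mem_enum.
Qed.

(* The step is a descent on the sum of the values, meant to close a gap [j]
   of [h] below [h x]. *)
Lemma gap_free_exists (T : finType) (Q : (T -> nat) -> Prop) :
    (forall h j x, Q h -> (forall y, h y != j) -> j < h x ->
       exists2 h', Q h' & \sum_y h' y < \sum_y h y) ->
  forall h, Q h -> exists2 f, Q f & gap_free f.
Proof.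
move=> step h; have [m] := ubnP (\sum_y h y).
elim: m h => // m IHm h le_m Qh.
have [|] := boolP (gap_free h); first by exists h.
case/forallPn=> x /forallPn[j /existsPn nj].
have [h' Qh' lt_h'] := step h j x Qh nj (ltn_ord j).
by apply: (IHm h') => //; apply: leq_trans lt_h' _.
Qed.

Lemma ltn_sum_at (T : finType) (f g : T -> nat) (x : T) :
  (forall y, f y <= g y) -> f x < g x -> \sum_y f y < \sum_y g y.
Proof.
move=> le_fg lt_x; rewrite (bigD1 x) //= [X in _ < X](bigD1 x) //=.
by rewrite -addSn leq_add // leq_sum.
Qed.

Definition ranks (T : finType) : {set {ffun T -> 'I_#|T|}} :=
  [set f : {ffun T -> 'I_#|T|} | gap_free (fun x => f x)].

Lemma ranks_of_gap_free (T : finType) (h : T -> nat) :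
  gap_free h -> exists2 f : {ffun T -> 'I_#|T|},
    f \in ranks T & forall x, f x = h x :> nat.
Proof.
move=> gh; have hE x : [ffun x => Ordinal (gap_free_lt_card gh x)] x = h x :> nat.
  by rewrite ffunE.
exists [ffun x => Ordinal (gap_free_lt_card gh x)] => //.
rewrite inE; apply/gap_freeP => x j; rewrite hE => /(gap_freeP _ gh)[y <-].
by exists y; rewrite hE.
Qed.

(** * The semiorder of a rank function *)

Definition alt_lt (T : finType) (f : T -> nat) : rel T :=
  fun x y => [&& ~~ odd (f x), odd (f y) & f x < f y].

Definition alt_order (T : finType) (f : T -> nat) : {set T * T} :=
  [set p | (p.1 == p.2) || alt_lt f p.1 p.2].

Lemma alt_orderE (T : finType) (f : T -> nat) x y :
  rel_of (alt_order f) x y = (x == y) || alt_lt f x y.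
Proof. by rewrite /rel_of inE. Qed.

Lemma alt_lt_trans_false (T : finType) (f : T -> nat) x y z :
  alt_lt f x y -> alt_lt f y z -> False.
Proof. by case/and3P=> _ oy _ /and3P[]; rewrite oy. Qed.

Lemma alt_order_partial (T : finType) (f : T -> nat) :
  partial_order_on [set: T] (alt_order f).
Proof.
apply/and4P; split.
- by apply/subsetP => p _; rewrite !inE.
- by apply/forall_inP => x _; rewrite alt_orderE eqxx.
- apply/forallP => x; apply/forallP => y; apply/implyP.
  rewrite !alt_orderE; case: eqVneq => //= _ /andP[xy].
  by move/(alt_lt_trans_false xy).
- apply/forallP => x; apply/forallP => y; apply/forallP => z; apply/implyP.
  rewrite !alt_orderE => /andP[/orP[/eqP->//|xy] /orP[/eqP<-|]].
    by rewrite xy orbT.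
  by move/(alt_lt_trans_false xy).
Qed.

(** Strict comparisons go from even to odd values, so there is no 3-element chain, let alone 3+1. An
    induced 2+2 with [a < b] and [c < d] would give [f a < f b <= f c < f d <= f a]. *)
Lemma alt_order_semiorder (T : finType) (f : T -> nat) :
  semiorder (alt_order f).
Proof.
apply/and3P; split; first exact: alt_order_partial.
  apply/existsP => -[g /andP[/injectiveP gi /forallP ge]].
  have E u v : rel_of (alt_order f) (g u) (g v) = two_chains_le u v.
    by have /forallP/(_ v)/eqP := ge u.
  have L u v : u != v -> two_chains_le u v = alt_lt f (g u) (g v).
    by move=> uv; rewrite -E alt_orderE (inj_eq gi) (negPf uv).
  pose o0 := @ord0 1; pose o1 := @ord_max 1.
  have /and3P[a1 a2 a3] : alt_lt f (g (inl o0)) (g (inl o1)) by rewrite -L.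
  have /and3P[b1 b2 b3] : alt_lt f (g (inr o0)) (g (inr o1)) by rewrite -L.
  have : ~~ alt_lt f (g (inl o0)) (g (inr o1)) by rewrite -L.
  have : ~~ alt_lt f (g (inr o0)) (g (inl o1)) by rewrite -L.
  rewrite /alt_lt a1 a2 b1 b2 /= -!leqNgt => da bc.
  by have := leq_trans (leq_trans a3 da) (leq_trans (ltnW b3) bc); rewrite ltnn.
apply/existsP => -[g /andP[/injectiveP gi /forallP ge]].
have E u v : rel_of (alt_order f) (g u) (g v) = two_chains_le u v.
  by have /forallP/(_ v)/eqP := ge u.
have L u v : u != v -> two_chains_le u v = alt_lt f (g u) (g v).
  by move=> uv; rewrite -E alt_orderE (inj_eq gi) (negPf uv).
pose o0 := @ord0 2; pose o1 := @Ordinal 3 1 isT; pose o2 := @ord_max 2.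
have a : alt_lt f (g (inl o0)) (g (inl o1)) by rewrite -L.
have b : alt_lt f (g (inl o1)) (g (inl o2)) by rewrite -L.
exact: alt_lt_trans_false a b.
Qed.

Lemma order_length_le1P (T : finType) (R : {set T * T}) :
  partial_order_on [set: T] R ->
  reflect (forall x y z, x != y -> y != z -> rel_of R x y -> rel_of R y z ->
             False)
          (order_length R <= 1).
Proof.
case/and4P=> _ /forall_inP rfl /forallP asym /forallP trans.
have tr x y z : rel_of R x y -> rel_of R y z -> rel_of R x z.
  move=> xy yz; have /forallP/(_ y)/forallP/(_ z)/implyP := trans x.
  by rewrite xy yz; apply.
have an x y : rel_of R x y -> rel_of R y x -> x = y.
  move=> xy yx; have /forallP/(_ y)/implyP := asym x.
  by rewrite xy yx => /(_ isT)/eqP.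
rewrite /order_length; apply: (iffP (bigmax_leqP _ _ _)) =>
  [len x y z xy yz Rxy Ryz | no3 C chC].
  have xz : x != z.
    by apply: contraNneq xy => xz; rewrite -xz in Ryz; rewrite (an x y).
  have Rxz := tr _ _ _ Rxy Ryz.
  have := len [set x; y; z].
  have -> : #|[set x; y; z]| = 3.
    by rewrite setUC cardsU1 !inE cards2 xy ![z == _]eq_sym (negPf xz) (negPf yz).
  move=> H; suff /H : chain R [set x; y; z] by [].
  apply/forall_inP => u uC; apply/forall_inP => v vC; move: uC vC.
  rewrite !inE -!orbA => /or3P[]/eqP-> /or3P[]/eqP->;
    by rewrite ?Rxy ?Rxz ?Ryz ?orbT // rfl ?inE.
rewrite leqNgt; apply/negP => C3.
have /card_geqP[s [us ss sC]] : 2 < #|C| by rewrite -ltn_predRL.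
case: s ss us sC => [|x [|y [|z []]]] //= _.
rewrite !inE negb_or !andbT => /andP[/andP[xy xz] yz] sC.
have Ch u v : u \in [:: x; y; z] -> v \in [:: x; y; z] ->
    rel_of R u v || rel_of R v u.
  move=> uC vC; have /forall_inP/(_ u (sC _ uC))/forall_inP := chC.
  by apply; apply: sC.
have [yx zx zy] : [/\ y != x, z != x & z != y].
  by rewrite ![_ == x]eq_sym [z == _]eq_sym.
have Cxy := Ch x y; have Cxz := Ch x z; have Cyz := Ch y z.
rewrite !inE !eqxx ?orbT in Cxy Cxz Cyz.
(* Three pairwise comparable elements form a tournament, and each of its eight orientations contains
   a directed path through all three vertices, which [no3] forbids. *)
have [|] := orP (Cxy isT isT); have [|] := orP (Cxz isT isT);
  have [|] := orP (Cyz isT isT); move=> *;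
  first [ apply: (no3 x y z); assumption | apply: (no3 x z y); assumption
        | apply: (no3 y x z); assumption | apply: (no3 y z x); assumption
        | apply: (no3 z x y); assumption | apply: (no3 z y x); assumption ].
Qed.

(** * Each semiorder of length at most one comes from exactly one rank *)

Lemma gap_free_odd (T : finType) (f : T -> nat) y :
  gap_free f -> odd (f y) = [exists x, alt_lt f x y].
Proof.
move=> /gap_freeP gf; apply/idP/existsP => [oy | [x /and3P[]] //].
have [x fx] := gf y 0 (odd_gt0 oy).
by exists x; rewrite /alt_lt fx oy odd_gt0.
Qed.

(** The order determines parities: an odd rank exceeds rank 0, which is taken, so odd means
    non-minimal. Then induct on [g x], through an element whose [g]-rank is one less. Exchanging [f]
    and [g] gives uniqueness. *)
Lemma alt_lt_inj_le (T : finType) (f g : T -> nat) :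
  gap_free f -> gap_free g -> alt_lt f =2 alt_lt g -> forall x, g x <= f x.
Proof.
move=> gf gg fg x.
have od y : odd (f y) = odd (g y).
  by rewrite !gap_free_odd //; apply: eq_existsb => z; rewrite fg.
have [m] := ubnP (g x); elim: m x => // m IHm x; rewrite ltnS => gm.
case E: (g x) => [//|k].
have [y gy] : exists y, g y = k by apply: (gap_freeP _ gg x); rewrite E.
have fy : k <= f y by rewrite -gy; apply: IHm; lia.
(* If [k] is even then [y < x]; if [k] is odd then [y] is not above [x].  In
   both cases [f y < f x]. *)
have := fg x y; have := fg y x; have := od x; have := od y.
rewrite /alt_lt gy E; lia.
Qed.

Lemma alt_lt_of_order (T : finType) (f : T -> nat) x y :
  alt_lt f x y = (x != y) && rel_of (alt_order f) x y.
Proof.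
rewrite alt_orderE; case: eqVneq => //= ->.
by rewrite /alt_lt ltnn !andbF.
Qed.

Lemma alt_order_inj (T : finType) :
  {in ranks T &, injective (fun f : {ffun T -> 'I_#|T|} =>
                              alt_order (fun x => f x))}.
Proof.
move=> f g; rewrite !inE => gf gg fg.
have fg2 : alt_lt (fun x => f x) =2 alt_lt (fun x => g x).
  by move=> x y; rewrite !alt_lt_of_order fg.
apply/ffunP => x; apply/val_inj/eqP; rewrite eqn_leq /=.
by rewrite (alt_lt_inj_le gf gg fg2) (alt_lt_inj_le gg gf) // => y z; rewrite fg2.
Qed.

(** A representing function with gaps is built from the sizes of strict up-sets, and
    [gap_free_exists] then closes the gaps. *)
Lemma alt_rank_exists (T : finType) (R : {set T * T}) :
  semiorder R -> order_length R <= 1 ->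
  exists2 f : T -> nat, gap_free f & alt_order f = R.
Proof.
case/and3P=> pR no22 _ /(order_length_le1P pR) no3.
have /and4P[_ /forall_inP rfl _ _] := pR.
pose lt x y := (x != y) && rel_of R x y.
have lt3 x y z : lt x y -> lt y z -> False.
  by move=> /andP[xy Rxy] /andP[yz Ryz]; apply: (no3 x y z).
have ltn x : lt x x = false by rewrite /lt eqxx.
have relE x y : rel_of R x y = (x == y) || lt x y.
  by rewrite /lt; case: eqVneq => //= ->; rewrite rfl ?inE.
(* Nestedness of strict up-sets: a violation is an induced 2+2. The non-comparabilities other than
   [ad] and [cb] follow from the absence of 3-element chains. *)
have nest a b c d : lt a b -> lt c d -> ~~ lt a d -> ~~ lt c b -> False.
  move=> ab cd ad cb; case/negP: no22.
  pose g (u : 'I_2 + 'I_2) := match u with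
    | inl i => if i == ord0 then a else b
    | inr i => if i == ord0 then c else d end.
  have [ac ca] : lt a c = false /\ lt c a = false.
    by split; apply/negP=> H; [apply: lt3 H cd | apply: lt3 H ab].
  have [bd db] : lt b d = false /\ lt d b = false.
    by split; apply/negP=> H; [apply: lt3 ab H | apply: lt3 cd H].
  have [ba bc] : lt b a = false /\ lt b c = false.
    by split; apply/negP=> H; apply: lt3 ab H.
  have [da dc] : lt d a = false /\ lt d c = false.
    by split; apply/negP=> H; apply: lt3 cd H.
  have neq u v w : lt u v -> lt w v = false -> ((u == w) = false) * ((w == u) = false).
    move=> uv wv; rewrite [w == u]eq_sym.
    by have -> : (u == w) = false by apply: contraFF wv => /eqP<-.
  have ltF := (ltn, ac, ca, bd, db, ba, bc, da, dc, negPf ad, negPf cb, ab, cd).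
  have eqF := (neq _ _ _ ab (ltn b), neq _ _ _ cd (ltn d), neq _ _ _ ab (negPf cb),
    neq _ _ _ ab db, neq _ _ _ cd bd).
  (* [neq] separates elements by what lies above them. Nothing lies above [b] or [d], so these are
     separated by [a], which is below [b] only. *)
  have bdF : ((b == d) = false) * ((d == b) = false).
    rewrite [d == b]eq_sym.
    by have -> : (b == d) = false by apply: contraFF (negPf ad) => /eqP<-.
  have E : forall u v, rel_of R (g u) (g v) = two_chains_le u v.
    by move=> [] [[|[|]] // i] [] [[|[|]] // j]; rewrite relE /= ?eqxx ?eqF ?bdF ?ltF.
  apply/existsP; exists [ffun u => g u]; apply/andP; split.
    apply/injectiveP; move=> [] [[|[|]] // i] [] [[|[|]] // j]; rewrite !ffunE /= => /eqP;
      rewrite ?eqF ?bdF // => _; congr (_ _); exact: val_inj.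
  by apply/forallP => u; apply/forallP => v; rewrite !ffunE E.
pose U x := #|[set y | lt x y]|.
pose D y := [exists x, lt x y].
(* The first clause alone would let an isolated point take an odd value below all even ones. The
   parity clause excludes this, and the descent needs it for the value 1. *)
pose Q (h : T -> nat) :=
  (forall x y, lt x y = alt_lt h x y) /\ (forall y, odd (h y) = D y).
suff [h Qh] : exists h, Q h.
  have [|f [ltE _] gf] := gap_free_exists (Q := Q) _ Qh; last first.
    exists f => //; apply/setP => -[x y].
    have := alt_orderE f x y; rewrite -ltE -relE; exact.
  move=> {Qh} {}h j x [hE hD] nj jx.
  (* Parities must be kept, hence the shift by 2.  When [j] = 0 the value 1 is
     not taken either, so truncated subtraction is harmless. *)
  exists (fun y => if j < h y then h y - 2 else h y).
    have j0 y : j < h y -> 1 < h y.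
      case: (posnP j) => [j0|]; last by lia.
      move=> jy; have : h y != 1; last by lia.
      apply/eqP => y1; have := hD y; rewrite y1 => /esym/existsP[z].
      rewrite hE => /and3P[_ _]; rewrite y1; have := nj z; lia.
    split=> [y z|y]; last by rewrite -hD; case: ifP => // /j0; lia.
    rewrite hE /alt_lt; have := nj y; have := nj z; have := j0 y; have := j0 z.
    by case: (ltnP j (h y)); case: (ltnP j (h z)); lia.
  apply: (ltn_sum_at (x := x)) => [y|]; first by case: ifP => //; lia.
  rewrite jx; lia.
pose M y := \max_(x | lt x y) (#|T| - U x).
(* Doubling leaves an odd value free right after each even one. *)
exists (fun y => if D y then (M y).*2.+1 else (#|T| - U y).*2).
split=> [x y|y]; last by case: ifP; rewrite /= odd_double.
have parity u : odd (if D u then (M u).*2.+1 else (#|T| - U u).*2) = D u.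
  by case: ifP; rewrite /= odd_double.
rewrite /alt_lt !parity.
have [Dx|nDx] /= := boolP (D x).
  by apply/negP => xy; case/existsP: Dx => z /lt3; apply; exact: xy.
have [Dy|nDy] /= := boolP (D y); last first.
  by apply: contraNF nDy => xy; apply/existsP; exists x.
rewrite ltnS leq_double; apply/idP/idP => [xy|]; first exact: leq_bigmax_cond.
have [z0 z0y] := existsP Dy.
have [z zy ->] : exists2 z, lt z y & M y = #|T| - U z.
  have [|z zy Mz] := @eq_bigmax_cond _ [pred z | lt z y] (fun x => #|T| - U x).
    by apply/card_gt0P; exists z0.
  by exists z.
(* Here [z] has the smallest up-set among the elements below [y]. If [x] is not below [y],
   nestedness puts the up-set of [x] inside that of [z], strictly because of [y]. *)
rewrite leq_sub2lE ?max_card // leqNgt; apply: contraNT => nxy.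
apply: proper_card; apply/properP; split; last by exists y; rewrite inE.
apply/subsetP => w; rewrite !inE => xw; apply/negPn/negP => zw.
exact: nest xw zy nxy zw.
Qed.

Lemma card_semiorders_length_le1 (T : finType) :
  #|[set R : {set T * T} | semiorder R && (order_length R <= 1)]| = #|ranks T|.
Proof.
rewrite -(card_in_imset (@alt_order_inj T)); apply: eq_card => R; rewrite inE.
apply/andP/imsetP => [[sR lR] | [f _ ->]].
  have [h gh <-] := alt_rank_exists sR lR.
  have [f rf fE] := ranks_of_gap_free gh; exists f => //.
  by apply/setP => p; rewrite !inE /alt_lt !fE.
split; first exact: alt_order_semiorder.
apply/order_length_le1P => [|x y z xy yz]; first exact: alt_order_partial.
rewrite !alt_orderE (negPf xy) (negPf yz); exact: alt_lt_trans_false.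
Qed.

(** * Ordered partitions as ranks *)

Definition rank_partition (T : finType) (f : T -> nat) :=
  preim_partition f [set: T].

Definition rank_order (T : finType) (f : T -> nat) : {set {set T} * {set T}} :=
  [set (pblock (rank_partition f) p.1, pblock (rank_partition f) p.2)
     | p : T * T & f p.1 <= f p.2].

Lemma rank_partitionP (T : finType) (f : T -> nat) :
  partition (rank_partition f) [set: T].
Proof. exact: preim_partitionP. Qed.

Lemma eq_pblock_rank (T : finType) (f : T -> nat) x y :
  (pblock (rank_partition f) x == pblock (rank_partition f) y) = (f x == f y).
Proof.
have /and3P[/eqP cP tP _] := rank_partitionP f.
rewrite eq_pblock ?cP ?inE // pblock_equivalence_partition ?inE //.
by split=> // /eqP->.
Qed.

Lemma rank_orderE (T : finType) (f : T -> nat) x y :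
  rel_of (rank_order f) (pblock (rank_partition f) x)
    (pblock (rank_partition f) y) = (f x <= f y).
Proof.
apply/imsetP/idP => [[[u v]]|le_xy]; last by exists (x, y); rewrite ?inE.
rewrite inE /= => le_uv [] /eqP; rewrite eq_pblock_rank => /eqP->.
by move=> /eqP; rewrite eq_pblock_rank => /eqP->.
Qed.

Lemma partition_block_pblock (T : finType) (P : {set {set T}}) B :
  partition P [set: T] -> B \in P -> exists x, B = pblock P x.
Proof.
case/and3P=> _ tP nP BP; have [B0|[x xB]] := set_0Vmem B.
  by rewrite -B0 BP in nP.
by exists x; rewrite (def_pblock tP BP xB).
Qed.

Lemma rank_order_linear (T : finType) (f : T -> nat) :
  linear_order_on (rank_partition f) (rank_order f).
Proof.
have pP := rank_partitionP f; have /and3P[/eqP cP tP _] := pP.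
have inP x : pblock (rank_partition f) x \in rank_partition f.
  by rewrite pblock_mem // cP.
have sub A B : rel_of (rank_order f) A B ->
    (exists x, A = pblock (rank_partition f) x) /\
    (exists x, B = pblock (rank_partition f) x).
  by case/imsetP=> -[u v] _ [-> ->]; split; [exists u | exists v].
apply/andP; split; last first.
  apply/forall_inP => A /(partition_block_pblock pP)[x ->].
  apply/forall_inP => B /(partition_block_pblock pP)[y ->].
  by rewrite !rank_orderE leq_total.
apply/and4P; split.
- by apply/subsetP => -[A B] /sub[[x ->] [y ->]]; rewrite inE /= !inP.
- apply/forall_inP => A /(partition_block_pblock pP)[x ->].
  by rewrite rank_orderE.
- apply/forallP => A; apply/forallP => B; apply/implyP => /andP[AB].
  have [[x xA] [y yB]] := sub _ _ AB; move: AB.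
  by rewrite xA yB !rank_orderE eq_pblock_rank eqn_leq => -> ->.
- apply/forallP => A; apply/forallP => B; apply/forallP => C.
  apply/implyP => /andP[AB BC].
  have [_ [z zC]] := sub _ _ BC; have [[x xA] [y yB]] := sub _ _ AB.
  move: AB BC; rewrite xA yB zC !rank_orderE; exact: leq_trans.
Qed.

(** The value just below [g x] is taken at some [y]. Then [f y < f x] too, so the bound passes from
    [y] to [x]. *)
Lemma gap_free_le_inj (T : finType) (f g : T -> nat) :
    gap_free g -> (forall x y, (f x <= f y) = (g x <= g y)) ->
  forall x, g x <= f x.
Proof.
move=> gg fg x; have [m] := ubnP (g x); elim: m x => // m IHm x.
rewrite ltnS => gm; case E: (g x) => [//|k].
have [y gy] : exists y, g y = k by apply: (gap_freeP _ gg x); rewrite E.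
have fy : k <= f y by rewrite -gy; apply: IHm; lia.
have := fg x y; rewrite gy E; lia.
Qed.

Lemma rank_partition_inj (T : finType) :
  {in ranks T &, injective (fun f : {ffun T -> 'I_#|T|} =>
     (rank_partition (fun x => f x), rank_order (fun x => f x)))}.
Proof.
move=> f g; rewrite !inE => gf gg [Pfg Lfg].
have fg (x y : T) : (f x <= f y) = (g x <= g y).
  by rewrite -(rank_orderE (fun x => f x)) Pfg Lfg rank_orderE.
apply/ffunP => x; apply/val_inj/eqP; rewrite eqn_leq /=.
rewrite (gap_free_le_inj (f := fun x => f x) gg fg).
by rewrite (gap_free_le_inj (f := fun x => g x) gf) // => y z; rewrite fg.
Qed.

Lemma linear_rank_exists (T : finType) (P : {set {set T}}) L :
    partition P [set: T] -> linear_order_on P L ->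
  exists2 f : T -> nat, gap_free f & (rank_partition f, rank_order f) = (P, L).
Proof.
move=> pP /andP[/and4P[/subsetP sL /forall_inP rfl /forallP asym /forallP trans] chL].
have /and3P[/eqP cP tP _] := pP.
have tr A B C : rel_of L A B -> rel_of L B C -> rel_of L A C.
  move=> xy yz; have /forallP/(_ B)/forallP/(_ C)/implyP := trans A.
  by rewrite xy yz; apply.
have an A B : rel_of L A B -> rel_of L B A -> A = B.
  move=> xy yx; have /forallP/(_ B)/implyP := asym A.
  by rewrite xy yx => /(_ isT)/eqP.
have inP x : pblock P x \in P by rewrite pblock_mem // cP.
pose le x y := rel_of L (pblock P x) (pblock P y).
have le_total x y : le x y || le y x.
  by have /forall_inP/(_ _ (inP x))/forall_inP := chL; apply.
pose Q (h : T -> nat) := forall x y, le x y = (h x <= h y).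
suff [h Qh] : exists h, Q h.
  have [|f Qf gf] := gap_free_exists (Q := Q) _ Qh; last first.
    exists f => //.
    have PE : rank_partition f = P.
      rewrite -[RHS](equivalence_partition_pblock pP).
      (* Equal rank means that the two blocks precede each other, so they coincide by
         antisymmetry. *)
      apply: eq_in_imset => x _; apply/setP => y; rewrite !inE /=.
      rewrite -eq_pblock ?cP ?inE // eqn_leq -!Qf.
      by apply/andP/eqP => [[]|]; [exact: an | rewrite /le => ->; rewrite rfl].
    congr pair => //; apply/setP => -[A B].
    apply/imsetP/idP => [[[x y]]|AB].
      by rewrite inE /= PE -Qf => lexy [-> ->].
    have := sL _ AB; rewrite inE /= => /andP[].
    move=> /(partition_block_pblock pP)[x Ax] /(partition_block_pblock pP)[y By].
    by exists (x, y); rewrite ?inE /= -?Qf ?PE /le -Ax -By.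
  move=> {Qh} {}h j x Qh nj jx.
  (* Since [j] is not a value, lowering everything above it by one merges no two values and keeps
     all comparisons. *)
  exists (fun y => if j < h y then (h y).-1 else h y).
    move=> y z; rewrite Qh; have := nj y; have := nj z.
    by case: (ltnP j (h y)); case: (ltnP j (h z)); lia.
  apply: (ltn_sum_at (x := x)) => [y|]; first by case: ifP => //; lia.
  rewrite jx; lia.
(* These are cumulative block sizes: they are ordered as the blocks are, but miss 0 and skip values
   at blocks with several elements. *)
exists (fun x => #|[set z | le z x]|) => x y; apply/idP/idP => [xy|].
  by apply/subset_leq_card/subsetP => z; rewrite !inE => zx; apply: tr zx xy.
apply: contraLR => nxy; rewrite -ltnNge; apply: proper_card.
have yx : le y x by have := le_total x y; rewrite (negPf nxy).
apply/properP; split; last by exists x; rewrite inE ?nxy // /le rfl.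
by apply/subsetP => z; rewrite !inE => zy; apply: tr zy yx.
Qed.

Lemma card_linearly_ordered_partitions (T : finType) :
  #|[set PL : {set {set T}} * {set {set T} * {set T}} |
      partition PL.1 [set: T] && linear_order_on PL.1 PL.2]| = #|ranks T|.
Proof.
rewrite -(card_in_imset (@rank_partition_inj T)); apply: eq_card => -[P L].
rewrite inE; apply/andP/imsetP => /= [[pP lL] | [f _ [-> ->]]]; last first.
  by split; [exact: rank_partitionP | exact: rank_order_linear].
have [h gh <-] := linear_rank_exists pP lL.
have [f rf fE] := ranks_of_gap_free gh; exists f => //.
have PE : rank_partition h = rank_partition (fun x => f x).
  apply: eq_in_imset => x _; apply/setP => y; rewrite !inE /=.
  by rewrite -!fE.
congr pair => //; apply/setP => p; rewrite /rank_order PE.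
by apply/imsetP/imsetP => -[q]; rewrite inE /= ?fE => le_q ->;
  exists q; rewrite ?inE /= ?fE.
Qed.

Theorem theorem5p7 (n : nat) (hn : 1 <= n) :
  #|semiorders_length_le1 n| = #|ordered_partitions n|.
Proof.
by rewrite card_semiorders_length_le1 card_linearly_ordered_partitions.
Qed.
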